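(* For every finite set $S\subseteq\mathbb{N}_{>1}$, $\forall n\,(\operatorname{R}_S(n)\to\operatorname{C}(n))$ and $\neg\forall n\,(\operatorname{C}(n)\to\operatorname{R}_S(n))$.
   Context: $\mathbb{N}_{>1}$ is the set of integers greater than $1$; $n$ ranges over positive integers; logic is intuitionistic. $\operatorname{C}(n)$ (composite) means $\exists a,b\le n\,(a>1\wedge b>1\wedge ab=n)$. For a finite set $S\subseteq\mathbb{N}_{>1}$, the catcher generated by $S$ is $\operatorname{R}_S(n)\iff\exists d\in S\,\exists b>1\,(db=n)$. *)

(* Defs.v *)
From mathcomp Require Import all_boot finmap.
Set Implicit Arguments.
Unset Strict Implicit.
Unset Printing Implicit Defensive.

Definition composite (n : nat) : Prop :=
  exists a b : nat, [/\ a <= n, b <= n, 1 < a, 1 < b & a * b = n].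

Definition catcher (S : {fset nat}) (n : nat) : Prop :=
  exists2 d : nat, d \in S & exists2 b : nat, 1 < b & d * b = n.

(* Main.v *)
Require Import Defs.
From mathcomp Require Import all_boot finmap.

(** A caught number [d * b] is composite with the very factors [d] and [b],
    since every [d] in [S] exceeds 1.  Conversely a finite [S] is bounded, so
    Euclid's theorem gives a prime [p] above all of its elements; the composite
    number [p * p] escapes [S], because its only divisors greater than 1 are
    [p] and [p * p] ([prime_square_divisor_ge]), both too large to lie in [S].
    The prime [p] is computed from [S], so the refutation is constructive. *)

(** A positive [d < p] is coprime to [p], hence to [p * p], which it can only
    divide when it is 1. *)
Lemma prime_square_divisor_ge (p d : nat) :
  prime p -> 1 < d -> d %| p * p -> p <= d.
Proof.
move=> p_pr d_gt1 d_dvd; rewrite leqNgt; apply/negP => d_lt_p.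
have co_dp : coprime d p.
  by rewrite coprime_sym prime_coprime // gtnNdvd // ltnW.
move: d_dvd; rewrite Gauss_dvdr // => d_dvd_p.
by move: co_dp; rewrite /coprime (gcdn_idPl d_dvd_p) gtn_eqF.
Qed.

Theorem corollary4p4p1 (S : {fset nat}) (S_gt1 : forall d : nat, d \in S -> 1 < d) :
  (forall n : nat, 0 < n -> catcher S n -> composite n) /\
  ~ (forall n : nat, 0 < n -> composite n -> catcher S n).
Proof.
split=> [n _ [d dS [b b_gt1 <-]] | caught].
  have d_gt1 := S_gt1 d dS.
  by exists d, b; split=> //; [apply: leq_pmulr | apply: leq_pmull]; apply: ltnW.
have [p p_big p_pr] := prime_above (\max_(d <- S) d).
have p_gt0 := prime_gt0 p_pr; have p_gt1 := prime_gt1 p_pr.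
have [||d dS [b _ db_eq]] := caught (p * p).
- by rewrite muln_gt0 p_gt0.
- by exists p, p; split=> //; apply: leq_pmulr.
have d_le : d <= \max_(e <- S) e by apply: (@leq_bigmax_seq nat (enum_fset S) xpredT id).
have d_lt_p : d < p := leq_ltn_trans d_le p_big.
have := prime_square_divisor_ge p d p_pr (S_gt1 d dS).
by rewrite -db_eq dvdn_mulr // leqNgt d_lt_p => /(_ isT).
Qed.
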